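(* Let $\vdash$ be an algebraizable logic with equivalent algebraic semantics the quasivariety $\mathbf{Y}$, and let $f$ be a selector term. The map $\mathsf{QVar}^f$ is a dual isomorphism between the complete lattices $\Lambda^f(\vdash)$ and $\Xi^f(\mathbf{Y})$.
   Context: Let $\mathcal{L}$ be an algebraic language, $\mathsf{Prop}$ a fixed countably infinite set of variables, $Tm(\mathcal{L},\mathsf{Prop})$ the set of terms (formulas). A consequence relation on a set $C$ is a relation between subsets and elements of $C$ that is reflexive ($W\vdash a$ if $a\in W$) and satisfies cut (if $W\vdash v$ for all $v\in V$ and $V\vdash a$ then $W\vdash a$); all consequence relations are assumed finitary (if $W\vdash a$ then $V\vdash a$ for some finite $V\subseteq W$). A logic is a substitution-invariant consequence relation on $Tm(\mathcal{L},\mathsf{Prop})$. $\Lambda(\vdash)$ is the complete lattice of (finitary) logics extending $\vdash$. A quasivariety is a class of algebras closed under isomorphisms, subalgebras and reduced products; $\Xi(\mathbf{Y})$ is the lattice of subquasivarieties of $\mathbf{Y}$. For a class $\mathbf{K}$, $\Theta\vDash_{\mathbf{K}}\gamma\approx\delta$ means that every assignment into an algebra of $\mathbf{K}$ satisfying all equations in $\Theta$ satisfies $\gamma\approx\delta$. The logic $\vdash$ is algebraizable with equivalent algebraic semantics the quasivariety $\mathbf{Y}$ (of language $\mathcal{L}$), witnessed by a finite set $\mu(x)$ of equations in one variable and a finite set $\Delta(x,y)$ of formulas in two variables: (1) $\Gamma\vdash\phi$ iff $\mu[\Gamma]\vDash_{\mathbf{Y}}\mu(\phi)$; (2) $\Theta\vDash_{\mathbf{Y}}\gamma\approx\delta$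 iff $\Delta[\Theta]\vdash\Delta(\gamma,\delta)$; (3) $\phi\dashv\vdash\Delta[\mu(\phi)]$; (4) $\gamma\approx\delta$ and $\mu[\Delta(\gamma,\delta)]$ are $\vDash_{\mathbf{Y}}$-interderivable. Here $\mu[\Gamma]$ is the union of the sets $\mu(\psi)$ for $\psi\in\Gamma$, and $\Delta[\Theta]$ is the union of the sets $\Delta(\varepsilon,\upsilon)$ for $\varepsilon\approx\upsilon$ in $\Theta$. A unary term $f(x)$ of $\mathcal{L}$ is a selector term if it is idempotent, i.e. $f(f(x))\dashv\vdash f(x)$ (each of $f(f(x))$ and $f(x)$ is derivable from the other in $\vdash$). $\chi[f(\overline p)/\overline p]$ is the result of substituting $f(q)$ for each variable $q$ in $\chi$, and $\Gamma[f(\overline p)/\overline p]$ is defined elementwise. For $\vdash_*\in\Lambda(\vdash)$, $\vdash_*^f$ is defined by $\Gamma\vdash_*^f\phi$ iff $\Gamma[f(\overline p)/\overline p]\vdash_*\phi[f(\overline p)/\overline p]$. $\Lambda^f(\vdash)=\{\vdash_*^f:\ \vdash_*\in\Lambda(\vdash)\}$, the $\mathsf{PAt}$-$f$-logics ordered by inclusion (a complete lattice). For $\mathcal{A}\in\mathbf{Y}$, $\mathcal{A}^f=\{a\in A:f(a)=a\}$. For $\mathcal{A},\mathcal{B}\in\mathbf{Y}$, $\mathcal{B}\preceq_f\mathcal{A}$ ($\mathcal{A}$ is a core superalgebra of $\mathcal{B}$) means $\mathcal{B}$ is a subalgebra of $\mathcal{A}$ and $\mathcal{A}^f=\mathcal{B}^f$.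 For $\mathbf{K}\in\Xi(\mathbf{Y})$, $\mathbf{K}^\uparrow=\{\mathcal{A}\in\mathbf{Y}:\exists\mathcal{B}\in\mathbf{K},\ \mathcal{B}\preceq_f\mathcal{A}\}$. $\Xi^f(\mathbf{Y})=\{\mathbf{K}^\uparrow:\mathbf{K}\in\Xi(\mathbf{Y})\}$, the $\mathsf{PAt}$-$f$-quasivarieties ordered by inclusion (a complete lattice). $\mathcal{A}\vDash_f(\Gamma,\phi)$ means: for each $v:\mathsf{Prop}\to\mathcal{A}^f$, if $\mathcal{A},v\vDash\mu[\Gamma]$ then $\mathcal{A},v\vDash\mu(\phi)$. $\mathsf{QVar}^f(\vdash_s)=\{\mathcal{A}\in\mathbf{Y}:\mathcal{A}\vDash_f(\Gamma,\phi)\text{ for all }(\Gamma,\phi)\in{\vdash_s}\}$.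
   Formalization: The selector term f is additionally assumed idempotent as an operation on Y, i.e. Y satisfies f(f(x)) ≈ f(x); with only f(f(x)) ⊣⊢ f(x) the map QVar^f need not be injective. *)

(* Defs.v *)
From Stdlib Require Fin.
From mathcomp Require Import all_boot.
From mathcomp Require Import boolp classical_sets functions cardinality filter.

Set Implicit Arguments.
Unset Strict Implicit.
Unset Printing Implicit Defensive.

Local Open Scope classical_set_scope.

(* Arguments are indexed by [Fin.t n], which is in [Set], because the universe
   of ['I_n] is above that of [set]: with ['I_n], terms could neither form an
   algebra nor index a reduced product once sets of algebras are considered. *)
Record language : Type := Language { op : Type; arity : op -> nat }.

Inductive term (L : language) (X : Type) : Type :=
| Var : X -> term L X
| App : forall o : op L, (Fin.t (arity o) -> term L X) -> term L X.

Arguments Var {L X} _.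
Arguments App {L X} o _.

Fixpoint subst (L : language) (X Z : Type) (s : X -> term L Z) (t : term L X)
    : term L Z :=
  match t with
  | Var x => s x
  | App o ts => App o (fun k => subst s (ts k))
  end.

Notation fm L := (term L nat).

Definition equation (L : language) (X : Type) : Type := (term L X * term L X)%type.

(* One-variable terms are over [unit]; in two-variable terms, [false] is the
   variable x and [true] is the variable y. *)
Definition app1 (L : language) (X : Type) (t : term L unit) (a : term L X)
  : term L X := subst (fun _ => a) t.

Definition app2 (L : language) (X : Type) (t : term L bool) (a b : term L X)
  : term L X := subst (fun i : bool => if i then b else a) t.

Record algebra (L : language) : Type := Algebra {
  carrier :> Type;
  interp : forall o : op L, (Fin.t (arity o) -> carrier) -> carrier;
  carrier_inhabited : inhabited carrier
}.

Fixpoint eval (L : language) (A : algebra L) (X : Type) (v : X -> A)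
    (t : term L X) : A :=
  match t with
  | Var x => v x
  | App o ts => interp (fun k => eval v (ts k))
  end.

Definition satisfies (L : language) (A : algebra L) (X : Type) (v : X -> A)
  (e : equation L X) : Prop := eval v e.1 = eval v e.2.

Definition is_hom (L : language) (A B : algebra L) (h : A -> B) : Prop :=
  forall (o : op L) (a : Fin.t (arity o) -> A), h (interp a) = interp (h \o a).

Definition isomorphic (L : language) (A B : algebra L) : Prop :=
  exists h : A -> B, is_hom h /\ bijective h.

Record subuniverse (L : language) (A : algebra L) : Type := Subuniverse {
  in_sub :> A -> Prop;
  sub_nonempty : exists a, in_sub a;
  sub_closed : forall (o : op L) (a : Fin.t (arity o) -> A),
    (forall k, in_sub (a k)) -> in_sub (interp a)
}.

Lemma subalg_inhabited (L : language) (A : algebra L) (S : subuniverse A) :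
  inhabited {a : A | S a}.
Proof. by case: (sub_nonempty S) => a Sa; constructor; exists a. Qed.

Definition subalg (L : language) (A : algebra L) (S : subuniverse A)
  : algebra L :=
  Algebra
    (fun (o : op L) (a : Fin.t (arity o) -> {a : A | S a}) =>
       exist (fun x : A => S x) (interp (fun k => sval (a k)))
             (sub_closed (fun k => svalP (a k))))
    (subalg_inhabited S).

Section ReducedProduct.
Variables (L : language) (I : Type) (F : set_system I) (A : I -> algebra L).

Definition rp_rel (x y : forall i, A i) : Prop := F [set i | x i = y i].

(* Equivalence classes, as predicates.  Writing [set (forall i, A i)] here
   would put the carrier above the universe of [set], which then could not
   contain sets of algebras. *)
Definition rp_carrier : Type :=
  {C : (forall i, A i) -> Prop | exists x, C = rp_rel x}.

Definition rp_class (x : forall i, A i) : rp_carrier :=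
  exist (fun C => exists x, C = rp_rel x) (rp_rel x) (ex_intro _ x erefl).

Definition rp_repr (c : rp_carrier) : forall i, A i := sval (cid (svalP c)).

Lemma rp_inhabited : inhabited rp_carrier.
Proof.
have h : forall i, exists a : A i, True.
  by move=> i; case: (carrier_inhabited (A i)) => a; exists a.
exact: (inhabits (rp_class (fun i => sval (cid (h i))))).
Qed.

Definition reduced_product : algebra L :=
  Algebra
    (fun (o : op L) (c : Fin.t (arity o) -> rp_carrier) =>
       rp_class (fun i => interp (fun k => rp_repr (c k) i)))
    rp_inhabited.

End ReducedProduct.

(* [Filter F] allows the improper filter, and [I] may be empty, so every
   quasivariety contains the one-element algebras. *)
Definition quasivariety (L : language) (K : set (algebra L)) : Prop :=
  [/\ forall A B, isomorphic A B -> K A -> K B,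
      forall A (S : subuniverse A), K A -> K (subalg S)
    & forall (I : Type) (F : set_system I) (A : I -> algebra L),
        Filter F -> (forall i, K (A i)) -> K (reduced_product F A)].

Definition eq_conseq (L : language) (K : set (algebra L))
    (Theta : set (equation L nat)) (e : equation L nat) : Prop :=
  forall A, K A -> forall v : nat -> A,
    (forall e', Theta e' -> satisfies v e') -> satisfies v e.

(* A relation between sets and elements of [C], as a set of pairs. *)
Definition conseq (C : Type) : Type := set (set C * C).

Definition consequence_relation (C : Type) (vd : conseq C) : Prop :=
  [/\ forall W a, W a -> vd (W, a),
      forall V W a, (forall v, V v -> vd (W, v)) -> vd (V, a) -> vd (W, a)
    & forall W a, vd (W, a) ->
        exists V, [/\ finite_set V, V `<=` W & vd (V, a)]].

Definition logic (L : language) (vd : conseq (fm L)) : Prop :=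
  consequence_relation vd /\
  forall (s : nat -> fm L) Gamma phi,
    vd (Gamma, phi) -> vd (subst s @` Gamma, subst s phi).

Definition Lambda (L : language) (vd : conseq (fm L)) : set (conseq (fm L)) :=
  [set vd' | logic vd' /\ vd `<=` vd'].

Section Algebraizable.
Variables (L : language) (vd : conseq (fm L)) (Y : set (algebra L)).
Variables (mu : set (equation L unit)) (Delta : set (term L bool)).

Definition mu_fm (phi : fm L) : set (equation L nat) :=
  [set (app1 e.1 phi, app1 e.2 phi) | e in mu].

Definition mu_set (Gamma : set (fm L)) : set (equation L nat) :=
  \bigcup_(psi in Gamma) mu_fm psi.

Definition Delta_eqn (e : equation L nat) : set (fm L) :=
  [set app2 d e.1 e.2 | d in Delta].

Definition Delta_set (Theta : set (equation L nat)) : set (fm L) :=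
  \bigcup_(e in Theta) Delta_eqn e.

Record algebraizable : Prop := Algebraizable {
  alg_logic : logic vd;
  alg_quasivariety : quasivariety Y;
  alg_mu_finite : finite_set mu;
  alg_Delta_finite : finite_set Delta;
  alg1 : forall Gamma phi,
    vd (Gamma, phi) <->
    (forall e, mu_fm phi e -> eq_conseq Y (mu_set Gamma) e);
  alg2 : forall Theta e,
    eq_conseq Y Theta e <->
    (forall psi, Delta_eqn e psi -> vd (Delta_set Theta, psi));
  alg3 : forall phi,
    (forall psi, Delta_set (mu_fm phi) psi -> vd ([set phi], psi)) /\
    vd (Delta_set (mu_fm phi), phi);
  alg4 : forall e,
    (forall e', mu_set (Delta_eqn e) e' -> eq_conseq Y [set e] e') /\
    eq_conseq Y (mu_set (Delta_eqn e)) e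
}.

End Algebraizable.

Section Selector.
Variables (L : language) (f : term L unit).

Definition selector_term (vd : conseq (fm L)) : Prop :=
  forall p : nat, let x := Var p : fm L in
  vd ([set app1 f (app1 f x)], app1 f x) /\
  vd ([set app1 f x], app1 f (app1 f x)).

(* Idempotence of the term operation, i.e. f maps each A in Y onto A^f.
   It implies [selector_term] when Y is an equivalent algebraic semantics of
   the logic, but not conversely, and it is what the correspondence between
   p |-> f(p) and valuations in A^f rests on.  With [selector_term] alone
   QVar^f may fail to be injective.  Take operations 1, e(x,y), f(x), and let Y
   be axiomatized by
     e(x,x) = 1,   f(e(x,y)) = e(x,y),
     e(x,y) = 1 => x = y,   f(f(x)) = 1 => f(x) = 1,
   with mu(x) = {x = 1} and Delta(x,y) = {e(x,y)}.  Every A^f is then a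
   subalgebra, so Y and its subclass given by f(f(x)) = f(x) yield the same
   QVar^f, whereas e(f(x),x)[f(x)/x] is a theorem of the logic of the subclass
   only. *)
Definition idempotent_on (Y : set (algebra L)) : Prop :=
  forall p : nat, let x := Var p : fm L in
  eq_conseq Y set0 (app1 f (app1 f x), app1 f x).

Definition f_subst (phi : fm L) : fm L := subst (fun p => app1 f (Var p)) phi.

Definition f_logic (vd : conseq (fm L)) : conseq (fm L) :=
  [set r | vd (f_subst @` r.1, f_subst r.2)].

Definition Lambda_f (vd : conseq (fm L)) : set (conseq (fm L)) :=
  f_logic @` Lambda vd.

Definition core (A : algebra L) : set A :=
  [set a | eval (fun _ => a) f = a].

Arguments core A : clear implicits.

Definition core_superalgebra (B A : algebra L) : Prop :=
  exists S : subuniverse A,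
    B = subalg S /\ core A = (fun b : subalg S => sval b) @` core (subalg S).

Definition Xi (Y : set (algebra L)) : set (set (algebra L)) :=
  [set K | quasivariety K /\ K `<=` Y].

Definition up (Y K : set (algebra L)) : set (algebra L) :=
  [set A | Y A /\ exists B, K B /\ core_superalgebra B A].

Definition Xi_f (Y : set (algebra L)) : set (set (algebra L)) :=
  up Y @` Xi Y.

Definition sat_f (mu : set (equation L unit)) (A : algebra L)
    (r : set (fm L) * fm L) : Prop :=
  forall v : nat -> A, (forall p, core A (v p)) ->
    (forall e, mu_set mu r.1 e -> satisfies v e) ->
    forall e, mu_fm mu r.2 e -> satisfies v e.

Definition QVar_f (Y : set (algebra L)) (mu : set (equation L unit))
    (vd : conseq (fm L)) : set (algebra L) :=
  [set A | Y A /\ forall r, vd r -> sat_f mu A r].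

End Selector.

Arguments core {L} f A.

Section Lattices.
Variables T U : Type.

Definition is_join (D S : set (set T)) (s : set T) : Prop :=
  [/\ D s, forall x, S x -> x `<=` s
    & forall u, D u -> (forall x, S x -> x `<=` u) -> s `<=` u].

Definition is_meet (D S : set (set T)) (s : set T) : Prop :=
  [/\ D s, forall x, S x -> s `<=` x
    & forall u, D u -> (forall x, S x -> u `<=` x) -> u `<=` s].

Definition complete_lattice (D : set (set T)) : Prop :=
  forall S, S `<=` D ->
    (exists s, is_join D S s) /\ (exists s, is_meet D S s).

Definition dual_isomorphism (D : set (set T)) (E : set (set U))
    (F : set T -> set U) : Prop :=
  set_bij D E F /\
  forall x y, D x -> D y -> (x `<=` y <-> F y `<=` F x).

End Lattices.

(* Main.v *)
From Stdlib Require List.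
Require Import Defs.
From mathcomp Require Import all_boot.
From mathcomp Require Import boolp classical_sets functions cardinality filter.

Set Implicit Arguments.
Unset Strict Implicit.
Unset Printing Implicit Defensive.

Local Open Scope classical_set_scope.

(** The map is read off from the classical duality between the extensions [l]
of [vd] and the subquasivarieties of [Y], followed by restriction to the core
[core f A] of each algebra [A].

Call [a] designated if the equations [mu] hold at [a].  An algebra validates
the rule (Gamma, phi) if every valuation that makes Gamma designated makes phi
designated.  [qvar l] is the class of the members of [Y] that validate all
rules of [l], and [log K] is the set of rules valid in [K].  These two maps are
mutually inverse:
- [qvar (log K) = K] ([qvar_log]).  An algebra of [Y] that validates all rules
  of [K] satisfies, by translation through [Delta], all the quasi-equations of
  [K] in countably many variables, and so lies in [K] by a Maltsev-style
  argument ([quasivariety_complete]): it embeds into a reduced product of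
  members of [K].
- [log (qvar l)] is included in [l] ([log_qvar]).  The equations whose
  [Delta]-translation follows from Gamma in [l] form a theory closed under
  consequence in [Y].  They hence have a model in [Y] generated by a valuation
  that satisfies nothing else ([theory_model]), and in this Lindenbaum algebra
  the designated formulas are those that follow from Gamma.

The link with cores is that, for [A] in [Y], the algebra [A] is an f-model of
the f-logic of [l] exactly when the subalgebra generated by the core of [A]
belongs to [qvar l] ([QVar_f_of_sub], [qvar_core_sub]).  Indeed substituting
f(p) for p does not change values under valuations in the core, and every
valuation in the generated subalgebra is a substitution followed by such a
valuation.  Hence [QVar_f] maps the f-logic of [l] to the class of core
superalgebras of members of [qvar l] ([QVar_f_f_logic]), which gives
surjectivity.  Order is reflected ([QVar_f_reflects_order]) because f maps
each [A] in [Y] into its core, so that a rule after the substitution of f(p)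
for p is tested on the core only.

For completeness, [up f Y K] is determined by which core-generated subalgebras
lie in [K], so upward closure commutes with intersections of subquasivarieties
and [Xi_f f Y] has all meets ([Xi_f_meet]); joins follow as meets of upper
bounds, and [Lambda_f f vd] inherits completeness through the dual
isomorphism. *)

(** * Terms, homomorphisms and subalgebras *)

Section Evaluation.
Variable L : language.

Lemma subst_subst (X Z W : Type) (s : X -> term L Z) (r : Z -> term L W) t :
  subst r (subst s t) = subst (fun x => subst r (s x)) t.
Proof. by elim: t => //= o ts IH; congr App; apply: funext. Qed.

Lemma eval_subst (A : algebra L) (X Z : Type) (s : X -> term L Z) (v : Z -> A) t :
  eval v (subst s t) = eval (fun x => eval v (s x)) t.
Proof. by elim: t => //= o ts IH; congr interp; apply: funext. Qed.

Lemma eval_hom (A B : algebra L) (h : A -> B) (X : Type) (v : X -> A) t :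
  is_hom h -> h (eval v t) = eval (h \o v) t.
Proof.
by move=> hh; elim: t => //= o ts IH; rewrite hh; congr interp; apply: funext.
Qed.

Lemma satisfies_hom (A B : algebra L) (h : A -> B) (X : Type) (v : X -> A) e :
  is_hom h -> injective h -> satisfies (h \o v) e <-> satisfies v e.
Proof.
move=> hh hi; rewrite /satisfies -!eval_hom //; split=> [/hi //|-> //].
Qed.

Lemma sval_inj (T : Type) (P : T -> Prop) : injective (@sval T P).
Proof. by move=> [x Px] [y Py] /= exy; apply: eq_exist. Qed.

Lemma sval_hom (A : algebra L) (S : subuniverse A) :
  is_hom (fun a : subalg S => sval a).
Proof. by []. Qed.

Lemma image_closed (A B : algebra L) (h : A -> B) : is_hom h ->
  forall (o : op L) (b : Fin.t (arity o) -> B),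
    (forall k, exists a, h a = b k) -> exists a, h a = interp b.
Proof.
move=> hh o b /choice[a ha]; exists (interp a).
by rewrite hh; congr interp; apply: funext.
Qed.

Lemma image_nonempty (A B : algebra L) (h : A -> B) : exists b, exists a, h a = b.
Proof. by case: (carrier_inhabited A) => a; exists (h a), a. Qed.

Definition image_sub (A B : algebra L) (h : A -> B) (hh : is_hom h)
    : subuniverse B :=
  Subuniverse (image_nonempty h) (image_closed hh).

(** [A] is isomorphic to the subalgebra of [B] on the image of [h]. *)
Lemma quasivariety_embedding (K : set (algebra L)) (A B : algebra L)
    (h : A -> B) :
  quasivariety K -> is_hom h -> injective h -> K B -> K A.
Proof.
case=> isoK subK _ hh hi KB.
apply: isoK (subK _ (image_sub hh) KB).
exists (fun b : subalg (image_sub hh) => sval (cid (svalP b))).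
have hK (b : subalg (image_sub hh)) : h (sval (cid (svalP b))) = sval b.
  exact: svalP (cid (svalP b)).
split.
- move=> o b; apply: hi; rewrite hK hh /=; congr interp.
  by apply: funext => k /=; rewrite hK.
- exists (fun a => exist _ (h a) (ex_intro _ a erefl)).
  + by move=> b; apply: sval_inj; rewrite /= hK.
  + by move=> a; apply: hi; rewrite hK.
Qed.

(** The elements named by a term under [v] form a subuniverse.  The type [X] of
variables is arbitrary, since [v] is a countable valuation in one use and the
inclusion of a whole core in another. *)
Section Generated.
Variables (A : algebra L) (X : Type) (v : X -> A).

Lemma generated_nonempty : inhabited X -> exists a, exists t, eval v t = a.
Proof. by case=> x; exists (v x), (Var x). Qed.

Lemma generated_closed (o : op L) (a : Fin.t (arity o) -> A) :
  (forall k, exists t, eval v t = a k) -> exists t, eval v t = interp a.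
Proof.
move=> /choice[t ht]; exists (App o t) => /=.
by congr interp; apply: funext.
Qed.

Definition generated (x0 : inhabited X) : subuniverse A :=
  Subuniverse (generated_nonempty x0) generated_closed.

End Generated.

Lemma enum_fin (T : Type) n (a : Fin.t n -> T) (x0 : T) :
  exists h : nat -> T, forall k, exists m, h m = a k.
Proof.
elim: n a => [|n IH] a; first exists (fun=> x0) => k.
  exact: (Fin.case0 (fun k => exists m, x0 = a k) k).
have [h hP] := IH (fun k => a (Fin.FS k)).
exists (fun m => if m is m'.+1 then h m' else a Fin.F1) => k.
apply: (Fin.caseS' k (fun k => exists m, _ = a k)); first by exists 0.
by move=> k'; have [m hm] := hP k'; exists m.+1.
Qed.

(** Interleaving along a pairing of the naturals; [c] says where each entry of
each sequence went. *)
Lemma merge_streams (T : Type) (h : nat -> nat -> T) :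
  exists (g : nat -> T) (c : nat -> nat -> nat), forall i j, g (c i j) = h i j.
Proof.
exists (fun m => if unpickle m is Some ij then h ij.1 ij.2 else h 0 0).
by exists (fun i j => pickle (i, j)) => i j; rewrite pickleK.
Qed.

(** A term contains only finitely many variables.  Indexing them by [nat] through
a not necessarily injective [h] makes the induction a matter of interleaving
the sequences obtained for the arguments. *)
Lemma term_countable (X : Type) (x0 : inhabited X) (t : term L X) :
  exists (h : nat -> X) (t' : fm L), t = subst (Var \o h) t'.
Proof.
case: x0 => x0; elim: t => [x|o ts]; first by exists (fun=> x), (Var 0).
move=> /choice[h /choice[t' htt']].
have [H HP] := enum_fin h (fun=> x0).
move: HP => /choice[m Hm].
have [g [c gc]] := merge_streams H.
exists g, (App o (fun k => subst (fun i => Var (c (m k) i)) (t' k))) => /=.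
congr App; apply: funext => k; rewrite htt' subst_subst; congr subst.
by apply: funext => i /=; rewrite gc Hm.
Qed.

Lemma terms_countable (X : Type) (x0 : inhabited X) (t : nat -> term L X) :
  exists (h : nat -> X) (t' : nat -> fm L),
    forall n, t n = subst (Var \o h) (t' n).
Proof.
have /choice[h /choice[t' htt']] := fun n => term_countable x0 (t n).
have [g [c gc]] := merge_streams h.
exists g, (fun n => subst (fun i => Var (c n i)) (t' n)) => n.
rewrite htt' subst_subst; congr subst.
by apply: funext => i /=; rewrite gc.
Qed.

End Evaluation.

(** * Reduced products *)

Lemma filter_forall_fin (I : Type) (F : set_system I) n
    (P : Fin.t n -> set I) : Filter F ->
  (forall k, F (P k)) -> F [set i | forall k, P k i].
Proof.
move=> FF; elim: n P => [|n IH] P FP.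
  apply: filterS filterT => i _ k; exact: Fin.case0 (fun k => P k i) k.
have FS := IH (fun k => P (Fin.FS k)) (fun k => FP (Fin.FS k)).
apply: filterS (filterI (FP Fin.F1) FS) => i [P1 PS] k.
by apply: (Fin.caseS' k (fun k => P k i)).
Qed.

Lemma filter_forall_finite (I T : Type) (F : set_system I) (V : set T)
    (P : T -> set I) : Filter F -> finite_set V ->
  (forall a, V a -> F (P a)) -> F [set i | forall a, V a -> P a i].
Proof.
move=> FF; elim/Pchoice: T => T in V P *.
move=> /finite_seqP[s ->]; elim: s => [|a s IH] FP.
  by apply: (filterS (P := setT)); [|exact: filterT].
have Fs : F [set i | forall a, [set` s] a -> P a i].
  by apply: IH => b bs; apply: FP; rewrite /= inE bs orbT.
apply: filterS (filterI (FP a _) Fs); last by rewrite /= inE eqxx.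
by move=> i [Pa Ps] b; rewrite /= inE => /orP[/eqP-> //|/Ps].
Qed.

Section ReducedProductTheory.
Variables (L : language) (I : Type) (F : set_system I) (A : I -> algebra L).
Hypothesis FF : Filter F.

Lemma rp_class_eq (x y : forall i, A i) :
  rp_class F x = rp_class F y <-> F [set i | x i = y i].
Proof.
split=> [exy|Fxy].
  have : rp_rel F y y by apply: (filterS (P := setT)) => //; exact: filterT.
  by rewrite -[rp_rel F y]/(sval (rp_class F y)) -exy.
apply: eq_exist; apply/predeqP => z; split=> Fz.
- by apply: filterS (filterI Fxy Fz) => i /= [<-].
- by apply: filterS (filterI Fxy Fz) => i /= [->].
Qed.

Lemma rp_reprK (c : rp_carrier F A) : rp_class F (rp_repr c) = c.
Proof.
apply: sval_inj => /=.
by rewrite /rp_repr; case: cid => x /= ->.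
Qed.

Lemma rp_interp (o : op L) (a : Fin.t (arity o) -> forall i, A i) :
  @interp L (reduced_product F A) o (fun k => rp_class F (a k))
  = rp_class F (fun i => interp (fun k => a k i)).
Proof.
apply/rp_class_eq.
have Fa k : F [set i | rp_repr (rp_class F (a k)) i = a k i].
  by apply/rp_class_eq; rewrite rp_reprK.
apply: filterS (filter_forall_fin FF Fa) => i /= ai.
by congr interp; apply: funext.
Qed.

Lemma rp_eval (X : Type) (v : X -> forall i, A i) (t : term L X) :
  @eval L (reduced_product F A) X (fun x => rp_class F (v x)) t
  = rp_class F (fun i => eval (fun x => v x i) t).
Proof.
elim: t => [//|o ts IH].
rewrite -[LHS]/(@interp L (reduced_product F A) o (fun k => eval _ (ts k))).
by rewrite (funext IH) rp_interp.
Qed.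

(** The equational case of the theorem of Los.  It holds for every filter,
since equations only involve finite intersections of members of [F]. *)
Lemma rp_satisfies (X : Type) (v : X -> forall i, A i) (e : equation L X) :
  @satisfies L (reduced_product F A) X (fun x => rp_class F (v x)) e
  <-> F [set i | satisfies (fun x => v x i) e].
Proof. by rewrite /satisfies !rp_eval; exact: rp_class_eq. Qed.

End ReducedProductTheory.

(** * Quasivarieties and their theories *)

Section Theories.
Variables (L : language) (K : set (algebra L)).
Hypothesis qK : quasivariety K.

(** Each equation outside [E] is refuted by some model of [E] in [K].  The direct
product of these models, which is the reduced product over the filter of the
full index set, satisfies [E] and nothing else along the tuple of their
valuations; pass to the subalgebra that this tuple generates. *)
Lemma theory_model (E : set (equation L nat)) :
  (forall e, eq_conseq K E e -> E e) ->
  exists (A : algebra L) (v : nat -> A),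
    [/\ K A, forall e, satisfies v e <-> E e
      & forall a, exists t, eval v t = a].
Proof.
move=> E_closed; case: (qK) => _ subK rpK.
have sep (e : {e | ~ E e}) : exists B : {B : algebra L & nat -> B},
    [/\ K (projT1 B), forall e', E e' -> satisfies (projT2 B) e'
      & ~ satisfies (projT2 B) (sval e)].
  case: e => e /= nEe; apply: contrapT => noB; apply/nEe/E_closed.
  move=> B KB v vE; apply: contrapT => nve.
  by apply: noB; exists (existT _ B v).
have {}/choice[B BP] := sep.
pose P := reduced_product (globally setT) (fun e => projT1 (B e)).
pose v (n : nat) : P := rp_class (globally setT) (fun e => projT2 (B e) n).
have vP e : satisfies v e <-> E e.
  rewrite rp_satisfies; split=> [ve|Ee i _]; last by case: (BP i) => _ + _; apply.
  apply: contrapT => nEe; have [_ _] := BP (exist _ e nEe).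
  by apply; exact: ve.
pose S := generated v (inhabits 0).
pose w (n : nat) : subalg S := exist _ (v n) (ex_intro _ (Var n) erefl).
exists (subalg S), w; split.
- by apply/subK/rpK => i; case: (BP i).
- by move=> e; rewrite -vP -(satisfies_hom w e (@sval_hom _ _ S) (@sval_inj _ _)).
- move=> [a [t ta]]; exists t; apply: sval_inj.
  by rewrite (eval_hom w t (@sval_hom _ _ S)).
Qed.

(** Maltsev's characterization of quasivarieties.  For each sequence [h] of
elements of [A], the equations true in [A] at [h] are closed under consequence
in [K], hence are exactly those true at some sequence [w h] of some [B h] in
[K].  Send [a] to the family whose [h]-th entry is the entry of [w h] at a
position where [h] takes the value [a].  Modulo the filter of the sets of [h]
containing all [h] that cover some fixed sequence, this is an embedding of [A]
into a reduced product of the [B h].  Sequences, rather than finite parts of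
[A], are used so that the variables are already natural numbers. *)
Lemma quasivariety_complete (A : algebra L) :
  (forall Theta e, eq_conseq K Theta e -> eq_conseq [set A] Theta e) -> K A.
Proof.
move=> A_sat; case: (qK) => _ _ rpK.
have mod (h : nat -> A) : exists B : {B : algebra L & nat -> B},
    K (projT1 B) /\ forall e, satisfies (projT2 B) e <-> satisfies h e.
  have [e /A_sat hE|B [v [KB vP _]]] := theory_model (E := satisfies h).
    exact: hE.
  by exists (existT _ B v).
have {mod}/choice[B BP] := mod.
have w_sat h e : satisfies (projT2 (B h)) e <-> satisfies h e.
  by case: (BP h).
pose w h : nat -> projT1 (B h) := projT2 (B h).
(* When [h] misses [a], the value 0 is arbitrary: the filter ignores such
   [h]. *)
pose pos (h : nat -> A) (a : A) : nat :=
  if pselect (exists i, h i = a) is left ex then sval (cid ex) else 0.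
pose g (a : A) (h : nat -> A) : projT1 (B h) := w h (pos h a).
have gE h i : g (h i) h = w h i.
  apply/(w_sat h (Var _, Var _)); rewrite /satisfies /= /pos.
  by case: pselect => [ex|[]]; [exact: svalP (cid ex)|exists i].
pose covers (h h' : nat -> A) := forall i, exists j, h' j = h i.
pose F : set_system (nat -> A) :=
  [set P | exists h, forall h', covers h h' -> P h'].
have FF : Filter F.
  split.
  - by case: (carrier_inhabited A) => a; exists (fun=> a).
  - move=> P Q [h1 h1P] [h2 h2Q].
    have [h [c hc]] := merge_streams (fun i => if i is 0 then h1 else h2).
    exists h => h' hh'; split.
    + by apply: h1P => i; have [j] := hh' (c 0 i); rewrite hc; exists j.
    + by apply: h2Q => i; have [j] := hh' (c 1 i); rewrite hc; exists j.
  - by move=> P Q PQ [h hP]; exists h => h' /hP /PQ.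
pose G : A -> reduced_product F (fun h => projT1 (B h)) :=
  fun a => rp_class F (g a).
apply: (quasivariety_embedding (h := G) qK).
- move=> o a; rewrite /G rp_interp; apply/(rp_class_eq FF).
  (* On sequences listing the [a k] and [interp a], the homomorphism condition
     is one equation of the theory of the sequence. *)
  have [h hP] := enum_fin a (interp a).
  exists (fun i => if i is i'.+1 then h i' else interp a) => h' hh'.
  have [j hj] := hh' 0.
  have /choice[m hm] k : exists m, h' m = a k.
    by have [i <-] := hP k; exact: (hh' i.+1).
  have ga k : g (a k) h' = w h' (m k) by rewrite -hm gE.
  rewrite /= -hj gE (funext ga).
  apply/(w_sat h' (Var j, App o (fun k => Var (m k)))).
  by rewrite /satisfies /= hj; congr interp; apply: funext => k; rewrite hm.
- move=> a b /(rp_class_eq FF)[h hP].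
  pose h' i := if i is 0 then a else if i is i'.+2 then h i' else b.
  have : g a h' = g b h' by apply: hP => i; exists i.+2.
  (* [h'] covers [h] and lists both [a] and [b]. *)
  rewrite (gE h' 0 : g a h' = _) (gE h' 1 : g b h' = _) => eq01.
  by apply/(w_sat h' (Var 0, Var 1)).
- by apply: rpK => h; case: (BP h).
Qed.

End Theories.

(** * Validity of rules and its Galois connection with quasivarieties *)

Section Designated.
Variables (L : language) (mu : set (equation L unit)).

Definition designated (A : algebra L) (a : A) : Prop :=
  forall e, mu e -> satisfies (fun _ : unit => a) e.

Definition valid (A : algebra L) (r : set (fm L) * fm L) : Prop :=
  forall v : nat -> A,
    (forall psi, r.1 psi -> designated (eval v psi)) -> designated (eval v r.2).

Lemma satisfies_mu_fm (A : algebra L) (v : nat -> A) phi :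
  (forall e, mu_fm mu phi e -> satisfies v e) <-> designated (eval v phi).
Proof.
have E e : satisfies v (app1 e.1 phi, app1 e.2 phi)
    <-> satisfies (fun _ : unit => eval v phi) e.
  by rewrite /satisfies /= !eval_subst.
split=> [vm e me|vm _ [e me <-]]; apply/E; last exact: vm.
by apply: vm; exists e.
Qed.

Lemma satisfies_mu_set (A : algebra L) (v : nat -> A) Gamma :
  (forall e, mu_set mu Gamma e -> satisfies v e)
  <-> forall psi, Gamma psi -> designated (eval v psi).
Proof.
split=> [vG psi Gpsi|vG e [psi Gpsi]].
- by apply/satisfies_mu_fm => e e_psi; apply: vG; exists psi.
- by move: e; apply/satisfies_mu_fm/vG.
Qed.

Lemma designated_hom (A B : algebra L) (h : A -> B) (a : A) :
  is_hom h -> injective h -> designated (h a) <-> designated a.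
Proof.
move=> hh hi; split=> da e me.
- exact/(satisfies_hom (fun=> a) e hh hi)/da.
- exact/(satisfies_hom (fun=> a) e hh hi)/da.
Qed.

Lemma valid_hom (A B : algebra L) (h : A -> B) r :
  is_hom h -> injective h -> valid B r -> valid A r.
Proof.
move=> hh hi Br v vr; apply/(designated_hom _ hh hi).
rewrite eval_hom //; apply: Br => psi /vr.
by rewrite -eval_hom // designated_hom.
Qed.

Hypothesis mu_finite : finite_set mu.

(** Finiteness of [mu] makes designation a finite conjunction of equations, to
which the theorem of Los applies. *)
Lemma rp_designated (I : Type) (F : set_system I) (A : I -> algebra L)
    (x : forall i, A i) : Filter F ->
  designated (rp_class F x : reduced_product F A)
  <-> F [set i | designated (x i)].
Proof.
move=> FF.
have E e := rp_satisfies FF (fun _ : unit => x) e.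
split=> [dx|dx e me].
- by apply: filter_forall_finite => // e me; apply/E/dx.
- by apply/E; apply: filterS dx => i; apply.
Qed.

Lemma valid_reduced_product (I : Type) (F : set_system I) (A : I -> algebra L)
    Gamma phi :
  Filter F -> finite_set Gamma -> (forall i, valid (A i) (Gamma, phi)) ->
  valid (reduced_product F A) (Gamma, phi).
Proof.
move=> FF finG A_valid v.
have -> : v = (fun n => rp_class F (rp_repr (v n))).
  by apply: funext => n; rewrite rp_reprK.
move=> vG; rewrite /= rp_eval; apply/rp_designated.
have FG psi : Gamma psi ->
    F [set i | designated (eval (fun n => rp_repr (v n) i) psi)].
  by move=> /vG; rewrite rp_eval => /rp_designated.
by apply: filterS (filter_forall_finite FF finG FG) => i; apply: A_valid.
Qed.

Definition log (K : set (algebra L)) : conseq (fm L) :=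
  [set r | forall A, K A -> valid A r].

(** Compactness.  If every finite part of [Gamma] is refuted together with
[phi] in [K], the reduced product of the refuting models, over the filter
generated by the sets of the lists extending a given list, designates all of
[Gamma] and not [phi]. *)
Lemma log_compact (K : set (algebra L)) Gamma phi :
  quasivariety K -> log K (Gamma, phi) ->
  exists V, [/\ finite_set V, V `<=` Gamma & log K (V, phi)].
Proof.
case=> _ _ rpK logG; apply: contrapT => noV.
pose part (s : seq (fm L)) : set (fm L) := [set psi | Gamma psi /\ List.In psi s].
have fin_part s : finite_set (part s).
  apply: (@sub_finite_set _ _ [set psi | List.In psi s]); first by move=> ? [].
  elim: s => [|a s IH]; first exact: finite_set0.
  apply: (@sub_finite_set _ _ ([set a] `|` [set psi | List.In psi s])).
    by move=> psi [<-|]; [left|right].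
  by rewrite finite_setU; split; [exact: finite_set1|].
have refute s : exists B : {B : algebra L & nat -> B},
    [/\ K (projT1 B),
        forall psi, part s psi -> designated (eval (projT2 B) psi)
      & ~ designated (eval (projT2 B) phi)].
  apply: contrapT => noB; apply: noV; exists (part s); split=> //.
    by move=> ? [].
  move=> B KB v vs; apply: contrapT => nphi.
  by apply: noB; exists (existT _ B v).
have {refute}/choice[B BP] := refute.
pose F : set_system (seq (fm L)) :=
  [set P | exists s, forall s', List.incl s s' -> P s'].
have FF : Filter F.
  split.
  - by exists [::].
  - move=> P Q [s sP] [s' sQ]; exists (s ++ s') => r inc; split.
    + by apply: sP => a sa; apply/inc/List.in_or_app; left.
    + by apply: sQ => a sa; apply/inc/List.in_or_app; right.
  - by move=> P Q PQ [s sP]; exists s => r /sP/PQ.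
pose R := reduced_product F (fun s => projT1 (B s)).
pose v n : R := rp_class F (fun s => projT2 (B s) n).
have : designated (eval v phi).
  apply: (logG R) => [|psi Gpsi]; first by apply: rpK => s; case: (BP s).
  rewrite /v rp_eval; apply/rp_designated; exists [:: psi] => s inc.
  by case: (BP s) => _ + _; apply; split=> //; apply: inc; left.
rewrite /v rp_eval => /rp_designated[s /(_ s (fun _ => id))].
by case: (BP s).
Qed.

Lemma log_logic (K : set (algebra L)) : quasivariety K -> logic (log K).
Proof.
move=> qK; split; first split.
- by move=> W a Wa A KA v vW; exact: vW.
- move=> V W a WV Va A KA v vW; apply: (Va A KA) => b /WV Wb.
  exact: (Wb A KA).
- by move=> W a; exact: log_compact.
- move=> s Gamma phi Gphi A KA v vG; rewrite /= eval_subst.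
  apply: (Gphi A KA) => psi Gpsi; rewrite -eval_subst.
  by apply: vG; exists psi.
Qed.

End Designated.

Section Algebraization.
Variables (L : language) (vd : conseq (fm L)) (Y : set (algebra L)).
Variables (mu : set (equation L unit)) (Delta : set (term L bool)).
Hypothesis h_alg : algebraizable vd Y mu Delta.

Let Y_qv : quasivariety Y := alg_quasivariety h_alg.
Let mu_fin : finite_set mu := alg_mu_finite h_alg.

Definition qvar (l : conseq (fm L)) : set (algebra L) :=
  [set A | Y A /\ forall r, l r -> valid mu A r].

(** Closure under reduced products is the point where finitariness of [l] is
used. *)
Lemma qvar_Xi l : logic l -> Xi Y (qvar l).
Proof.
move=> [[_ _ l_fin] _]; case: (Y_qv) => isoY subY rpY.
split; last by move=> A [].
split.
- move=> A B AB [YA lA]; split; first exact: isoY YA.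
  case: AB => h [hh [g gK hK]] r /lA.
  apply: (@valid_hom _ _ _ _ g); last exact: can_inj hK.
  move=> o b; apply: (can_inj gK); rewrite hK hh; congr interp.
  by apply: funext => k /=; rewrite hK.
- move=> A S [YA lA]; split; first exact: subY.
  by move=> r /lA; apply: valid_hom (@sval_hom _ _ S) (@sval_inj _ _).
- move=> I F A FF lA; split; first by apply: rpY => i; case: (lA i).
  move=> [Gamma phi] /l_fin[V [finV VG lV]] v vG.
  apply: (valid_reduced_product mu_fin (Gamma := V)) => //.
  + by move=> i; case: (lA i) => _; apply.
  + by move=> psi /VG /vG.
Qed.

Lemma vd_log Gamma phi : vd (Gamma, phi) <-> log mu Y (Gamma, phi).
Proof.
apply: iff_trans (alg1 h_alg Gamma phi) _; split.
- move=> H A YA v vG; apply/satisfies_mu_fm => e /H; apply=> //.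
  exact/satisfies_mu_set.
- move=> H e pe A YA v /satisfies_mu_set vG; move: e pe.
  exact/satisfies_mu_fm/(H A YA).
Qed.

Lemma log_Lambda K : Xi Y K -> Lambda vd (log mu K).
Proof.
move=> [qK KY]; split; first exact: log_logic.
by move=> [Gamma phi] /vd_log H A /KY; exact: H.
Qed.

(** In algebras of [Y], an equation and its translation [Delta] say the same,
which turns quasi-equations into rules. *)
Lemma satisfies_Delta (A : algebra L) (v : nat -> A) e : Y A ->
  satisfies v e
  <-> forall psi, Delta_eqn Delta e psi -> designated mu (eval v psi).
Proof.
move=> YA; have [to_D from_D] := alg4 h_alg e.
split=> [ve psi e_psi|/satisfies_mu_set ve]; last exact: from_D.
apply/satisfies_mu_fm => e' pe'.
by apply: (to_D e') => [|//|_ ->//]; exists psi.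
Qed.

Lemma satisfies_Delta_set (A : algebra L) (v : nat -> A) Theta : Y A ->
  (forall e, Theta e -> satisfies v e)
  <-> forall psi, Delta_set Delta Theta psi -> designated mu (eval v psi).
Proof.
move=> YA; split=> [vT psi [e Te e_psi]|vT e Te].
- by move: psi e_psi; apply/satisfies_Delta => //; exact: vT.
- by apply/satisfies_Delta => // psi e_psi; apply: vT; exists e.
Qed.

(** The rules from [Delta_set Delta Theta] to the members of the translation of
[e] express the consequence from [Theta] to [e] valid in [K]. *)
Lemma qvar_log K : Xi Y K -> qvar (log mu K) = K.
Proof.
move=> [qK KY]; apply/seteqP; split=> A; last first.
  by move=> KA; split; [exact: KY|move=> r; apply].
move=> [YA lA]; apply: (quasivariety_complete qK) => Theta e KTe _ -> v vT.
apply/satisfies_Delta => // psi e_psi.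
apply: (lA (Delta_set Delta Theta, psi)); last exact/satisfies_Delta_set.
move=> B KB w wT; apply: (satisfies_Delta w e (KY B KB)).1 e_psi.
by apply: KTe => //; apply/satisfies_Delta_set => //; exact: KY.
Qed.

(** The Lindenbaum construction relative to [Gamma]: [B] validates [l] because
each of its elements is the value of a term under [v], so that valuations in
[B] are substitutions. *)
Lemma log_qvar l : Lambda vd l -> log mu (qvar l) `<=` l.
Proof.
move=> [[[l_refl l_cut _] l_subst] vdl] [Gamma phi] Gphi.
pose E : set (equation L nat) :=
  [set e | forall psi, Delta_eqn Delta e psi -> l (Gamma, psi)].
have [|B [v [YB vE v_gen]]] := theory_model Y_qv (E := E).
  move=> e /(alg2 h_alg) Ee psi /Ee /vdl; apply: l_cut => chi [e' Ee' e'_chi].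
  exact: Ee'.
have dP chi : designated mu (eval v chi) <-> l (Gamma, chi).
  have [to_mu from_mu] := alg3 h_alg chi.
  split=> [/satisfies_mu_fm vchi|lchi].
  - apply: l_cut (vdl _ from_mu) => psi [e /vchi/vE Ee].
    exact: Ee.
  - apply/satisfies_mu_fm => e me; apply/vE => psi e_psi.
    apply: (@l_cut [set chi]) => [_ -> //|].
    by apply/vdl/to_mu; exists e.
apply/dP; apply: (Gphi B); last by move=> psi Gpsi; apply/dP/l_refl.
split=> // -[Gamma' phi'] lr w wG.
have /choice[s sP] := fun n => v_gen (w n).
have wE psi : eval w psi = eval v (subst s psi).
  by rewrite eval_subst; congr eval; apply: funext.
rewrite /= wE; apply/dP; apply: l_cut (l_subst s _ _ lr) => _ [psi Gpsi <-].
by apply/dP; rewrite -wE; exact: wG.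
Qed.

(** * Core superalgebras *)

Variable f : term L unit.
Hypothesis h_idem : idempotent_on f Y.

Lemma core_eval (A : algebra L) (a : A) : Y A -> core f A (eval (fun=> a) f).
Proof.
move=> YA; have := h_idem 0 YA (v := fun=> a).
by rewrite /satisfies /app1 /= !eval_subst; apply.
Qed.

Lemma core_inhabited (A : algebra L) : Y A -> inhabited {a : A | core f A a}.
Proof.
move=> YA; case: (carrier_inhabited A) => a.
by constructor; exists (eval (fun=> a) f); exact: core_eval.
Qed.

(** The least subalgebra of which [A] is a core superalgebra. *)
Definition core_sub (A : algebra L) (YA : Y A) : subuniverse A :=
  generated (fun a : {a : A | core f A a} => sval a) (core_inhabited YA).

Lemma core_sub_core (A : algebra L) (YA : Y A) a : core f A a -> core_sub YA a.
Proof. by move=> fa; exists (Var (exist _ a fa)). Qed.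

Lemma core_superalgebra_subalg (A : algebra L) (S : subuniverse A) :
  core f A `<=` S -> core_superalgebra f (subalg S) A.
Proof.
move=> fS; exists S; split=> //; apply/seteqP; split=> [a fa|_ [b fb <-]].
- exists (exist _ a (fS a fa)) => //; apply: sval_inj.
  by rewrite (eval_hom _ _ (@sval_hom _ _ S)).
- rewrite /core /= -[in RHS]fb.
  by rewrite (eval_hom _ _ (@sval_hom _ _ S)).
Qed.

Lemma eval_f_subst (A : algebra L) (v : nat -> A) psi :
  eval v (f_subst f psi) = eval (fun p => eval (fun=> v p) f) psi.
Proof.
rewrite eval_subst; congr eval; apply: funext => p.
by rewrite /app1 eval_subst.
Qed.

Lemma sat_fP (A : algebra L) Gamma phi :
  sat_f f mu A (Gamma, phi) <->
  forall v : nat -> A, (forall p, core f A (v p)) ->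
    (forall psi, Gamma psi -> designated mu (eval v psi)) ->
    designated mu (eval v phi).
Proof.
split=> H v fv vG; first by apply/satisfies_mu_fm/(H v fv)/satisfies_mu_set.
by apply/satisfies_mu_fm/H => //; apply/satisfies_mu_set.
Qed.

(** On valuations in the core, [f_subst f psi] and [psi] take the same value. *)
Lemma QVar_f_of_sub l (A : algebra L) (S : subuniverse A) :
  Y A -> core f A `<=` S -> qvar l (subalg S) -> QVar_f f Y mu (f_logic f l) A.
Proof.
move=> YA fS [_ lS]; split=> // -[Gamma phi] /lS S_valid.
apply/sat_fP => v fv vG.
pose w p : subalg S := exist _ (v p) (fS _ (fv p)).
have wE psi : sval (eval w (f_subst f psi)) = eval v psi.
  rewrite (eval_hom _ _ (@sval_hom _ _ S)) eval_f_subst.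
  by congr eval; apply: funext => p; exact: fv.
have dP := designated_hom mu _ (@sval_hom _ _ S) (@sval_inj _ _).
rewrite -wE; apply/dP/S_valid => _ [psi /vG vpsi <-].
by apply/dP; rewrite wE.
Qed.

(** A valuation in the subalgebra generated by the core chooses countably many
terms over core elements, which are instances, under one countable core
valuation [v], of a substitution [s].  Apply the f-logic to the image of the
rule under [s]. *)
Lemma qvar_core_sub l (A : algebra L) (YA : Y A) : logic l ->
  QVar_f f Y mu (f_logic f l) A -> qvar l (subalg (core_sub YA)).
Proof.
move=> [_ l_subst] [_ lA]; set S := core_sub YA.
split; first by case: Y_qv => _ + _; apply.
move=> [Gamma phi] lr w wG.
have /choice[t tP] p : exists t,
    eval (fun a : {a : A | core f A a} => sval a) t = sval (w p).
  by case: (w p).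
have [h [s sP]] := terms_countable (core_inhabited YA) t.
pose v p : A := sval (h p).
have wE psi : sval (eval w psi) = eval v (subst s psi).
  rewrite (eval_hom _ _ (@sval_hom _ _ S)) eval_subst.
  congr eval; apply: funext => p.
  by rewrite /= -tP sP eval_subst.
have dP := designated_hom mu _ (@sval_hom _ _ S) (@sval_inj _ _).
apply/dP; rewrite wE.
have /lA /sat_fP : f_logic f l (subst s @` Gamma, subst s phi).
  have := l_subst (fun p => f_subst f (s p)) _ _ lr.
  rewrite /f_logic /= image_comp /f_subst subst_subst.
  congr (l (_, _)); apply: eq_imagel => psi _.
  by rewrite /= subst_subst.
apply; first by move=> p; exact: svalP (h p).
by move=> _ [psi /wG Gpsi <-]; rewrite -wE; apply/dP.
Qed.

Lemma QVar_f_f_logic l : logic l ->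
  QVar_f f Y mu (f_logic f l) = up f Y (qvar l).
Proof.
move=> logl; apply/seteqP; split=> A.
- move=> lA; have [YA _] := lA; split=> //.
  exists (subalg (core_sub YA)); split; first exact: qvar_core_sub.
  exact/core_superalgebra_subalg/core_sub_core.
- move=> [YA [B [lB [S [eB fS]]]]]; rewrite eB in lB.
  have fsubS : core f A `<=` S by rewrite fS => _ [b _ <-]; exact: svalP b.
  exact: QVar_f_of_sub fsubS lB.
Qed.

Lemma up_QVar_f K : Xi Y K -> up f Y K = QVar_f f Y mu (f_logic f (log mu K)).
Proof.
move=> XK; rewrite QVar_f_f_logic ?qvar_log //.
by case: (log_Lambda XK).
Qed.

(** Membership in [up f Y K] can be tested on a subalgebra that does not depend
on [K]; this is what makes [up] commute with intersections. *)
Lemma up_core_sub K (A : algebra L) (YA : Y A) : Xi Y K ->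
  up f Y K A <-> K (subalg (core_sub YA)).
Proof.
move=> XK; split=> [|KA].
- rewrite up_QVar_f // => lA; rewrite -(qvar_log XK).
  by apply: qvar_core_sub => //; case: (log_Lambda XK).
- split=> //; exists (subalg (core_sub YA)); split=> //.
  exact/core_superalgebra_subalg/core_sub_core.
Qed.

(** By [log_qvar] it suffices to validate the translated rule in each [A] in
[qvar l2].  Such an [A] is an f-model of the f-logic of [l2], hence of that of
[l1], and composing any valuation with f yields one in the core. *)
Lemma QVar_f_reflects_order l1 l2 : Lambda vd l1 -> Lambda vd l2 ->
  QVar_f f Y mu (f_logic f l2) `<=` QVar_f f Y mu (f_logic f l1) ->
  f_logic f l1 `<=` f_logic f l2.
Proof.
move=> Ll1 Ll2 sub [Gamma phi] lr; apply: (log_qvar Ll2) => A l2A v vG.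
have [YA _] := l2A.
have : QVar_f f Y mu (f_logic f l1) A.
  apply: sub; rewrite QVar_f_f_logic; last by case: Ll2.
  have [[_ subK _] _] := qvar_Xi (proj1 Ll2).
  apply/(up_core_sub YA (qvar_Xi (proj1 Ll2))).
  exact: subK.
move=> [_ /(_ _ lr)/sat_fP valid_r].
rewrite /= eval_f_subst; apply: valid_r => [p|psi Gpsi]; first exact: core_eval.
by rewrite -eval_f_subst; apply: vG; exists psi.
Qed.

Lemma QVar_f_dual_isomorphism :
  dual_isomorphism (Lambda_f f vd) (Xi_f f Y) (QVar_f f Y mu).
Proof.
have order x y : Lambda_f f vd x -> Lambda_f f vd y ->
    (x `<=` y <-> QVar_f f Y mu y `<=` QVar_f f Y mu x).
  move=> [l1 Ll1 <-] [l2 Ll2 <-]; split; last exact: QVar_f_reflects_order.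
  by move=> sub A [YA l2A]; split=> // r /sub /l2A.
split=> //; split.
- move=> _ [l [logl _] <-]; exists (qvar l); first exact: qvar_Xi.
  by rewrite QVar_f_f_logic.
- move=> x y; rewrite !inE => Lx Ly exy.
  by apply/seteqP; split; apply/order; rewrite // exy.
- move=> _ [K XK <-]; exists (f_logic f (log mu K)).
    by exists (log mu K); [exact: log_Lambda|].
  by rewrite -up_QVar_f.
Qed.

(** The meet is the upward closure of the intersection, within [Y], of all the
subquasivarieties whose upward closure is in [S]; intersecting with [Y] gives
the top element when [S] is empty. *)
Lemma Xi_f_meet (S : set (set (algebra L))) : S `<=` Xi_f f Y ->
  exists s, is_meet (Xi_f f Y) S s.
Proof.
move=> SX.
pose K : set (algebra L) :=
  [set A | Y A /\ forall Q, Xi Y Q -> S (up f Y Q) -> Q A].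
have XK : Xi Y K.
  case: (Y_qv) => isoY subY rpY; split; last by move=> A [].
  split.
  - move=> A B AB [YA KA]; split; first exact: isoY YA.
    by move=> Q XQ /(KA _ XQ); case: XQ => -[isoQ _ _] _; exact: isoQ.
  - move=> A T [YA KA]; split; first exact: subY.
    by move=> Q XQ /(KA _ XQ); case: XQ => -[_ subQ _] _; exact: subQ.
  - move=> I F A FF KA; split; first by apply: rpY => i; case: (KA i).
    move=> Q XQ SQ; case: (XQ) => -[_ _ rpQ] _; apply: rpQ => i.
    by case: (KA i) => _; apply.
exists (up f Y K); split; first by exists K.
- move=> x Sx; have [Q XQ eQ] := SX x Sx; rewrite -eQ => A [YA].
  rewrite -eQ in Sx.
  by move=> [B [[_ KB] BA]]; split=> //; exists B; split=> //; exact: KB.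
- move=> u [Ku _ <-] u_low A uA; have [YA _] := uA.
  apply/(up_core_sub YA XK); split; first by case: Y_qv => _ + _; apply.
  by move=> Q XQ SQ; apply/(up_core_sub YA XQ)/(u_low _ SQ).
Qed.

End Algebraization.

(** * Complete lattices *)

Lemma complete_lattice_meets (T : Type) (D : set (set T)) :
  (forall S, S `<=` D -> exists s, is_meet D S s) -> complete_lattice D.
Proof.
move=> meets S SD; split; last exact: meets.
pose U := [set u | D u /\ forall x, S x -> x `<=` u].
have [s [Ds s_low s_max]] := meets U (fun _ => @proj1 _ _).
exists s; split=> // [x Sx|u Du Su]; last exact: s_low.
by apply: s_max => [|u [_ Su]]; [exact: SD|exact: Su].
Qed.

Lemma complete_lattice_dual (T U : Type) (D : set (set T)) (E : set (set U))
    (F : set T -> set U) :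
  dual_isomorphism D E F -> complete_lattice E -> complete_lattice D.
Proof.
move=> [[DE _ surj] order] cE; apply: complete_lattice_meets => S SD.
have [|[t [Et t_up t_min]] _] := cE (F @` S).
  by move=> _ [x /SD /DE Ex <-].
have [s Ds es] := surj t Et; rewrite -es in t_up t_min.
exists s; split=> // [x Sx|u Du u_low].
- by apply/order => //; [exact: SD|apply: t_up; exists x].
- apply/order => //; apply: t_min; first exact: DE.
  by move=> _ [x Sx <-]; apply/order => //; [exact: SD|exact: u_low].
Qed.

Theorem corollary3p27 (L : language) (vd : conseq (fm L))
    (Y : set (algebra L)) (mu : set (equation L unit)) (Delta : set (term L bool))
    (f : term L unit)
    (h_alg : algebraizable vd Y mu Delta)
    (h_sel : selector_term f vd)
    (h_idem : idempotent_on f Y) :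
  [/\ complete_lattice (Lambda_f f vd),
      complete_lattice (Xi_f f Y)
    & dual_isomorphism (Lambda_f f vd) (Xi_f f Y) (QVar_f f Y mu)].
Proof.
have iso := QVar_f_dual_isomorphism h_alg h_idem.
have cX : complete_lattice (Xi_f f Y).
  exact/complete_lattice_meets/(Xi_f_meet h_alg h_idem).
by split=> //; exact: complete_lattice_dual iso cX.
Qed.
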